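(* Let $\Omega$ be a verification operator for $|\Psi\rangle$ with second largest eigenvalue $\beta$ and spectral gap $\nu=1-\beta$, let $N\ge1$ be an integer, $0<\delta\le1$, and assume $0<\nu\le1$. Then $$F(N,\delta,\Omega)\ge 1-\frac{1-\delta}{N\nu\delta},$$ and this inequality is saturated when $\delta^*\le\delta\le1$, where $\delta^*=\frac{1+N\beta}{N+1}$. If in addition $\nu\ge1/2$, then $$F(N,\delta,\Omega)\ge1-\frac{1}{(N+1)\delta},$$ and this inequality is saturated when $\Omega$ is singular (i.e. has eigenvalue $0$) and $1/(N+1)\le\delta\le\delta^*$.
   Context: Let $\mathcal H$ be a Hilbert space of finite dimension $D\ge2$ and $|\Psi\rangle\in\mathcal H$ a unit vector. A verification operator for $|\Psi\rangle$ is a Hermitian operator $\Omega$ on $\mathcal H$ with $0\le\Omega\le1$, $\Omega|\Psi\rangle=|\Psi\rangle$, whose eigenvalue $1$ is nondegenerate; $\beta$ denotes its second largest eigenvalue. For an integer $N\ge1$ and a density operator $\rho$ on $\mathcal H^{\otimes(N+1)}$ put $p_\rho=\mathrm{tr}[(\Omega^{\otimes N}\otimes 1)\rho]$ and $f_\rho=\mathrm{tr}[(\Omega^{\otimes N}\otimes|\Psi\rangle\langle\Psi|)\rho]$, and $F(N,\delta,\Omega)=\min\{f_\rho/p_\rho:p_\rho\ge\delta\}$ for $0<\delta\le1$, the minimum over permutation-invariant density operators on $\mathcal H^{\otimes(N+1)}$. *)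

(* Defs.v *)
From HB Require Import structures.
From mathcomp Require Import all_boot all_order all_algebra all_fingroup.
From mathcomp Require Import all_real_closed.
From mathcomp Require Import reals.
Import Order.TTheory GRing.Theory Num.Theory.
Local Open Scope ring_scope.
Local Open Scope complex_scope.

Section QDefs.
Context {R : realType}.
Local Notation C := (R[i]).

Definition adj m n (A : 'M[C]_(m, n)) : 'M[C]_(n, m) := map_mx Num.conj A^T.

Definition psd n (A : 'M[C]_n) : Prop :=
  forall v : 'cV[C]_n, 0 <= (adj n 1 v *m A *m v) 0 0.

Definition density n (rho : 'M[C]_n) : Prop := psd n rho /\ \tr rho = 1.

Definition verif_op D (Om : 'M[C]_D) (Psi : 'cV[C]_D) : Prop :=
  [/\ (adj D 1 Psi *m Psi) 0 0 = 1,
      psd D Om, psd D (1%:M - Om),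
      Om *m Psi = Psi &
      \rank (eigenspace Om 1) = 1%N ].

(* beta is the second largest eigenvalue of Om (eigenvalue 1 being the
   largest one and nondegenerate, this is the largest eigenvalue != 1) *)
Definition second_eig D (Om : 'M[C]_D) (beta : R) : Prop :=
  [/\ eigenvalue Om beta%:C, beta%:C != 1 &
      forall a : C, eigenvalue Om a -> a != 1 -> a <= beta%:C].

(* Tensor power H^{(x)(N+1)} of H = C^D: basis indexed by maps 'I_(N+1) -> 'I_D. *)
Definition tidx (N D : nat) := {ffun 'I_N.+1 -> 'I_D}.
Definition tdim (N D : nat) := #|{: tidx N D}|.

Definition tmx N D (E : tidx N D -> tidx N D -> C) : 'M[C]_(tdim N D) :=
  \matrix_(i, j) E (enum_val i) (enum_val j).

Definition tens N D (A : 'I_N.+1 -> 'M[C]_D) : 'M[C]_(tdim N D) :=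
  tmx N D (fun x y => \prod_(k < N.+1) A k (x k) (y k)).

Definition permop N D (s : 'S_N.+1) : 'M[C]_(tdim N D) :=
  tmx N D (fun x y => (x == [ffun k => y (s k)])%:R).

Definition perm_inv N D (rho : 'M[C]_(tdim N D)) : Prop :=
  forall s : 'S_N.+1, permop N D s *m rho *m adj _ _ (permop N D s) = rho.

Definition OmN_id N D (Om : 'M[C]_D) : 'M[C]_(tdim N D) :=
  tens N D (fun k : 'I_N.+1 => if k == ord_max then 1%:M else Om).
Definition OmN_Psi N D (Om : 'M[C]_D) (Psi : 'cV[C]_D) : 'M[C]_(tdim N D) :=
  tens N D (fun k : 'I_N.+1 => if k == ord_max then Psi *m adj D 1 Psi else Om).

Definition p_rho N D (Om : 'M[C]_D) (rho : 'M[C]_(tdim N D)) : C :=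
  \tr (OmN_id N D Om *m rho).
Definition f_rho N D (Om : 'M[C]_D) (Psi : 'cV[C]_D) (rho : 'M[C]_(tdim N D)) : C :=
  \tr (OmN_Psi N D Om Psi *m rho).

Definition admissible N D (delta : R) (Om : 'M[C]_D) (rho : 'M[C]_(tdim N D)) : Prop :=
  [/\ density _ rho, perm_inv N D rho & delta%:C <= p_rho N D Om rho].

Definition F_ge N D (delta : R) (Om : 'M[C]_D) (Psi : 'cV[C]_D) (b : R) : Prop :=
  forall rho : 'M[C]_(tdim N D), admissible N D delta Om rho ->
    b%:C <= f_rho N D Om Psi rho / p_rho N D Om rho.

Definition F_eq N D (delta : R) (Om : 'M[C]_D) (Psi : 'cV[C]_D) (b : R) : Prop :=
  F_ge N D delta Om Psi b /\
  exists rho : 'M[C]_(tdim N D), admissible N D delta Om rho /\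
    f_rho N D Om Psi rho / p_rho N D Om rho = b%:C.

End QDefs.

(* Main.v *)
Require Import Defs.
From HB Require Import structures.
From mathcomp Require Import all_boot all_order all_algebra all_fingroup.
From mathcomp Require Import all_real_closed.
From mathcomp Require Import reals.
From mathcomp Require Import ring lra.
Import Order.TTheory GRing.Theory Num.Theory.
Local Open Scope ring_scope.

(** Diagonalise [Om] in an orthonormal basis containing [Psi], with eigenvalues
    [l i] ([l o = 1], and [0 <= l i <= beta] otherwise).  In the product basis
    only the diagonal [q] of the state matters, and [q] is a permutation-symmetric
    probability distribution on strings [x].  Averaging over the position left
    untested, the quantities [p] and [g = p - f] become [q]-averages of functions
    of [x] that are controlled by the number [m] of letters different from [o]:
    [(N+1) g <= m beta^(m-1)] and [(N+1) p <= m beta^(m-1) + (N+1-m) beta^m].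
    The Bernoulli-type inequality [m beta^(m-1) - (m-1) beta^m <= 1] then gives
    [N nu g + p <= 1], and [m beta^(m-1) <= 1] for [beta <= 1/2] gives
    [(N+1) g <= 1].  The first bound is an equality when [m = 0], or when [m = 1]
    with eigenvalue [beta]; the second whenever [m = 1], so mixing strings with
    eigenvalues [0] and [beta] saturates it for a whole range of [p]. *)

(** * Two power inequalities *)

(** The left side is 1 at [m = 0] and nonincreasing in [m]: passing from [m] to [m.+1] lowers it by
    [m.+1%:R * b ^+ m * (1 - b) ^+ 2]. *)
Lemma exp_bernoulli_le1 (R : realFieldType) (b : R) (m : nat) :
  0 <= b <= 1 -> m.+1%:R * b ^+ m - m%:R * b ^+ m.+1 <= 1.
Proof.
move=> /andP[b0 b1]; elim: m => [|m IH]; first by rewrite expr0 mul0r; lra.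
apply: le_trans IH; rewrite -subr_ge0.
have -> : m.+1%:R * b ^+ m - m%:R * b ^+ m.+1
    - (m.+2%:R * b ^+ m.+1 - m.+1%:R * b ^+ m.+2)
    = m.+1%:R * b ^+ m * (1 - b) ^+ 2.
  by rewrite !exprS -!(natr1 m.+1) -!natr1; ring.
by rewrite !mulr_ge0 ?exprn_ge0 // subr_ge0.
Qed.

(** Each step multiplies the left side by [b * (m+2)/(m+1)], which is at most 1 because
    [b <= 1/2]. *)
Lemma exp_half_le1 (R : realFieldType) (b : R) (m : nat) :
  0 <= b <= 1 / 2 -> m.+1%:R * b ^+ m <= 1.
Proof.
move=> /andP[b0 b1]; elim: m => [|m IH]; first by rewrite mul1r.
apply: le_trans IH; rewrite exprSr mulrA [_.+2%:R * _]mulrC -mulrA mulrC.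
apply: ler_wpM2r; first exact: exprn_ge0.
apply: le_trans (_ : m.+2%:R * (1 / 2) <= _); first exact: ler_wpM2l.
have m0 : 0 <= m%:R :> R := ler0n _ _.
by rewrite -(natr1 m.+1) -(natr1 m); lra.
Qed.

(** * Symmetric distributions on strings: pointwise bounds and single-flip mixtures *)

Section Symmetric.
Variables (R : realFieldType) (n : nat) (I : finType).
Implicit Types (x : {ffun 'I_n.+1 -> I}) (l h : I -> R).

Definition perm_symmetric {T : Type} (q : {ffun 'I_n.+1 -> I} -> T) :=
  forall (s : 'S_n.+1) x, q [ffun k => x (s k)] = q x.

(** Swapping position [j] with the last one preserves [q], so every choice of the untested position
    has the same mean. *)
Lemma sum_perm_symmetric (q : {ffun 'I_n.+1 -> I} -> R) h l :
  perm_symmetric q ->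
  n.+1%:R * (\sum_x q x * (h (x ord_max) * \prod_(k | k != ord_max) l (x k)))
  = \sum_x q x * \sum_j h (x j) * \prod_(k | k != j) l (x k).
Proof.
move=> qS; under [RHS]eq_bigr do rewrite mulr_sumr.
rewrite exchange_big /=; set p := \sum_x _.
have -> : n.+1%:R * p = \sum_(j < n.+1) p by rewrite sumr_const card_ord mulr_natl.
apply: eq_bigr => j _.
pose t x : {ffun 'I_n.+1 -> I} := [ffun k => x (tperm j ord_max k)].
have tK : involutive t by move=> x; apply/ffunP=> k; rewrite !ffunE tpermK.
rewrite (reindex_inj (inv_inj tK)) /=; apply: eq_bigr => x _.
rewrite qS /t ffunE tpermL; congr (_ * (_ * _)).
rewrite [LHS](reindex_inj (@perm_inj _ (tperm j ord_max))) /=.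
apply: eq_big => [k|k _]; last by rewrite /= !ffunE.
by rewrite /= -[X in _ != X](tpermL j ord_max) (inj_eq perm_inj).
Qed.

Section Pointwise.
Variables (o : I) (l : I -> R) (b : R).
Hypotheses (b0 : 0 <= b) (lo : l o = 1).
Hypothesis lb : forall i, i != o -> 0 <= l i <= b.

Lemma prod_le_exp x (P : pred 'I_n.+1) :
  0 <= \prod_(k | P k) l (x k) <= b ^+ #|[pred k | P k && (x k != o)]|.
Proof.
have l0 i : 0 <= l i by case: (eqVneq i o) => [->|/lb/andP[]//]; rewrite lo.
rewrite prodr_ge0 //= (bigID (fun k => x k != o)) /= mulrC big1 ?mul1r; last first.
  by move=> k /andP[_]; rewrite negbK => /eqP ->.
rewrite -prodr_const; apply: ler_prod => k /andP[_ /lb /andP[-> ->]] //.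
Qed.

Lemma card_pred_ne x j :
  #|[pred k | (k != j) && (x k != o)]| = (#|[pred k | x k != o]| - (x j != o))%N.
Proof.
rewrite (cardD1 j [pred k | x k != o]) inE addKn.
by apply: eq_card => k; rewrite !inE.
Qed.

(** Leaving out [j] removes a factor bounded by [b] exactly when [x j != o]. Indicators merge the
    two cases into a bound that can be summed over [j]; the truncated predecessor at count 0 is
    harmless, as its coefficient is then 0. *)
Lemma prod_other_le x j :
  \prod_(k | k != j) l (x k) <=
  (x j != o)%:R * b ^+ #|[pred k | x k != o]|.-1
  + (1 - (x j != o)%:R) * b ^+ #|[pred k | x k != o]|.
Proof.
have /andP[_] := prod_le_exp x (fun k => k != j).
by rewrite card_pred_ne; case: eqP => _;
   rewrite ?subn0 ?subn1 /= ?subr0 ?subrr ?mul1r ?mul0r ?addr0 ?add0r.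
Qed.

Lemma sum_pred_natr (J : finType) (P : pred J) :
  \sum_j (P j)%:R = #|P|%:R :> R.
Proof.
by rewrite -natr_sum -sum1_card [in RHS]big_mkcond; congr _%:R.
Qed.

Lemma sum_infidelity_le x :
  \sum_j (x j != o)%:R * \prod_(k | k != j) l (x k)
    <= #|[pred k | x k != o]|%:R * b ^+ #|[pred k | x k != o]|.-1.
Proof.
rewrite -sum_pred_natr mulr_suml; apply: ler_sum => j _ /=.
have := prod_other_le x j; case: eqP => _ /=; first by rewrite !mul0r.
by rewrite subrr mul0r addr0 !mul1r.
Qed.

Lemma sum_pass_le x (m := #|[pred k | x k != o]|) :
  \sum_j \prod_(k | k != j) l (x k)
    <= m%:R * b ^+ m.-1 + (n.+1%:R - m%:R) * b ^+ m.
Proof.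
apply: le_trans (ler_sum _ (fun j _ => prod_other_le x j)) _.
rewrite big_split /= -!mulr_suml sumrB sumr_const card_ord.
by rewrite (sum_pred_natr _ (fun k => x k != o)).
Qed.

Lemma sum_tradeoff_le x : b <= 1 ->
  n%:R * (1 - b) * (\sum_j (x j != o)%:R * \prod_(k | k != j) l (x k))
    + \sum_j \prod_(k | k != j) l (x k) <= n.+1%:R.
Proof.
move=> b1; have := sum_infidelity_le x; have := sum_pass_le x.
(* With no letter different from [o], [T <= 0] and [P <= n.+1]. With [m.+1] such letters, the two
   bounds add up exactly to [n.+1] times the left side of [exp_bernoulli_le1]. *)
set T := \sum_j _ * _; set P := \sum_j _; case: #|_| => [|m] /= hP hT.
  have: n%:R * (1 - b) * T <= 0.
    by rewrite mulr_ge0_le0 ?mulr_ge0 ?ler0n ?subr_ge0 //; move: hT; rewrite mul0r.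
  by move: hP; rewrite expr0 mul0r; lra.
have hT' : n%:R * (1 - b) * T <= n%:R * (1 - b) * (m.+1%:R * b ^+ m).
  by apply: ler_wpM2l hT; rewrite mulr_ge0 ?ler0n ?subr_ge0.
apply: le_trans (lerD hT' hP) _.
have b01 : 0 <= b <= 1 by rewrite b0.
have := ler_wpM2l (ler0n R n.+1) (exp_bernoulli_le1 R b m b01); rewrite mulr1.
by apply: le_trans; rewrite le_eqVlt; apply/orP; left; apply/eqP;
   rewrite exprS -(natr1 n) -(natr1 m); ring.
Qed.

Lemma sum_infidelity_le1 x : b <= 1 / 2 ->
  \sum_j (x j != o)%:R * \prod_(k | k != j) l (x k) <= 1.
Proof.
move=> b12; apply: le_trans (sum_infidelity_le x) _.
case: #|_| => [|m]; first by rewrite mul0r.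
by apply: exp_half_le1; rewrite b0.
Qed.

End Pointwise.

(* A string with at most one letter different from [o]: the position of that
   letter is uniform and its value has distribution [w] (which may charge [o]). *)
Definition one_flip_distr (o : I) (w : I -> R) x : R :=
  n.+1%:R^-1 * \sum_(j < n.+1) \sum_i w i * (x == [ffun k => if k == j then i else o])%:R.

Lemma one_flip_ge0 o w x : (forall i, 0 <= w i) -> 0 <= one_flip_distr o w x.
Proof.
move=> w0; rewrite mulr_ge0 ?invr_ge0 ?ler0n //.
by do 2!apply: sumr_ge0 => ? _; rewrite mulr_ge0 ?ler0n.
Qed.

Lemma one_flip_perm_symmetric o w : perm_symmetric (one_flip_distr o w).
Proof.
move=> s x; congr (_ * _); rewrite (reindex_inj (@perm_inj _ (s^-1)%g)) /=.
apply: eq_bigr => j _; apply: eq_bigr => i _; congr (_ * _%:R).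
congr nat_of_bool; apply/eqP/eqP => /ffunP e; apply/ffunP => k; rewrite !ffunE.
  by have := e ((s^-1)%g k); rewrite !ffunE permKV (inj_eq perm_inj).
by rewrite e ffunE -{2}[k](permK s) (inj_eq perm_inj).
Qed.

Lemma sum_one_flip o w (phi : {ffun 'I_n.+1 -> I} -> R) :
  \sum_x one_flip_distr o w x * phi x = n.+1%:R^-1 *
    \sum_(j < n.+1) \sum_i w i * phi [ffun k => if k == j then i else o].
Proof.
under eq_bigr do rewrite -mulrA; rewrite -mulr_sumr; congr (_ * _).
under eq_bigr do rewrite mulr_suml; rewrite exchange_big /=; apply: eq_bigr => j _.
under eq_bigr do rewrite mulr_suml; rewrite exchange_big /=; apply: eq_bigr => i _.
rewrite (bigD1 [ffun k => if k == j then i else o]) //= eqxx mulr1 big1 ?addr0 //.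
by move=> x /negPf ->; rewrite mulr0 mul0r.
Qed.

Lemma sum_one_flip1 o w : \sum_i w i = 1 -> \sum_x one_flip_distr o w x = 1.
Proof.
move=> w1; under eq_bigr do rewrite -[one_flip_distr o w _]mulr1.
rewrite (sum_one_flip o w (fun=> 1)).
under eq_bigr do (under eq_bigr do rewrite mulr1; rewrite w1).
by rewrite sumr_const card_ord mulVf // pnatr_eq0.
Qed.

(** If the flip hits the last position, [h] sees the flipped letter and all tested factors are 1. In
    the other [n] cases [h] sees [o] and exactly one tested factor is [l i]. *)
Lemma sum_one_flip_test o w l h :
  l o = 1 -> \sum_i w i = 1 ->
  \sum_x one_flip_distr o w x * (h (x ord_max) * \prod_(k | k != ord_max) l (x k))
  = (\sum_i w i * h i + n%:R * h o * \sum_i w i * l i) / n.+1%:R.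
Proof.
move=> lo w1; rewrite (sum_one_flip o w (fun x => h (x ord_max) * \prod_(k | k != ord_max) l (x k))).
rewrite mulrC; congr (_ / _).
rewrite (bigD1 ord_max) //=; congr (_ + _).
  apply: eq_bigr => i _; rewrite ffunE eqxx big1 ?mulr1 //.
  by move=> k /negPf e; rewrite ffunE e.
rewrite (eq_bigr (fun=> h o * \sum_i w i * l i)) => [|j jn].
  rewrite sumr_const -mulrA mulr_natl; congr (_ *+ _).
  by rewrite (cardC1 ord_max) card_ord.
rewrite mulr_sumr; apply: eq_bigr => i _.
rewrite ffunE eq_sym (negPf jn) (bigD1 j) //= ffunE eqxx big1 ?mulr1 1?mulrCA //.
by move=> k /andP[_ /negPf e]; rewrite ffunE e.
Qed.

End Symmetric.

(** * Positive semidefinite matrices and diagonalisation of a verification operator *)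

(** Polarisation: a nonnegative form takes real values, and reality on combinations of two basis
    vectors determines the conjugates of the entries. *)
Lemma form_ge0_hermitian (C : numClosedFieldType) n (A : 'M[C]_n) :
  (forall v : 'cV[C]_n, 0 <= (map_mx Num.conj v^T *m A *m v) 0 0) ->
  map_mx Num.conj A^T = A.
Proof.
move=> A0; pose e i : 'cV[C]_n := delta_mx i 0.
have eE c d i j :
    (map_mx Num.conj (c *: e i + d *: e j)^T *m A *m (c *: e i + d *: e j)) 0 0
    = c^* * c * A i i + c^* * d * A i j + d^* * c * A j i + d^* * d * A j j.
  have adje k m : (map_mx Num.conj (e k)^T *m A *m e m) 0 0 = A k m.
    have -> : map_mx Num.conj (e k)^T = delta_mx 0 k.
      by apply/matrixP => a b; rewrite !mxE conjC_nat andbC.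
    by rewrite -rowE -colE !mxE.
  have -> : map_mx Num.conj (c *: e i + d *: e j)^T
     = c^* *: map_mx Num.conj (e i)^T + d^* *: map_mx Num.conj (e j)^T.
    by apply/matrixP => a b; rewrite !mxE rmorphD !rmorphM.
  have sc a (X : 'M[C]_1) : (a *: X) 0 0 = a * X 0 0 by rewrite mxE.
  have ad (X Y : 'M[C]_1) : (X + Y) 0 0 = X 0 0 + Y 0 0 by rewrite mxE.
  rewrite mulmxDr !mulmxDl -!scalemxAl -!scalemxAr.
  by rewrite !(sc, ad) !adje; ring.
have eR c d i j := geC0_conj (A0 (c *: e i + d *: e j)).
apply/matrixP => i j; rewrite !mxE.
(* The first two vectors make the diagonal entries real; [e i + e j] and [e i + 'i *: e j] then give
   the sum and the difference of [A i j] and [A j i]. *)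
have := eR 1 0 i j; have := eR 0 1 i j; have := eR 1 1 i j; have := eR 1 'i i j.
rewrite !eE !conjC0 !conjC1 !conjCi !(mul0r, mul1r, mulr0, addr0, add0r, mulr1).
rewrite !(rmorphD, rmorphM, rmorphN) /= !conjCi => h1 h2 ejj eii.
move: h1 h2; rewrite eii ejj; move: (A i j)^* (A j i)^* => a b h1 h2.
have h3 : 'i * (b - a) = 'i * (A i j - A j i) :> C.
  apply/(addIr (A i i + - 'i * 'i * A j j))/(eq_trans _ (eq_trans h1 _)); ring.
have {}h3 := mulfI (neq0Ci _) h3; have {}h2 : a + b = A i j + A j i.
  by apply/(addIr (A i i + A j j))/(eq_trans _ (eq_trans h2 _)); ring.
apply: (@mulfI _ 2%:R); first by rewrite pnatr_eq0.
apply: (@eq_trans _ _ ((b - a) + (a + b))); first by ring.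
by rewrite h2 h3; ring.
Qed.

Local Open Scope complex_scope.

Section Spectral.
Variable R : realType.
Local Notation C := (R[i]).

Lemma adjM m n p (A : 'M[C]_(m, n)) (B : 'M_(n, p)) :
  adj m p (A *m B) = adj n p B *m adj m n A.
Proof. by rewrite /adj trmx_mul map_mxM. Qed.

Lemma adjK m n (A : 'M[C]_(m, n)) : adj n m (adj m n A) = A.
Proof. by apply/matrixP => i j; rewrite !mxE conjCK. Qed.

Lemma row_mul_adj m n p (A : 'M[C]_(m, n)) (B : 'M_(p, n)) i j :
  (row i A *m adj 1 n (row j B)) 0 0 = (A *m adj p n B) i j.
Proof. by rewrite !mxE; apply: eq_bigr => k _; rewrite !mxE. Qed.

Lemma adj_delta_form n (A : 'M[C]_n) i j :
  (adj n 1 (delta_mx i 0) *m A *m (delta_mx j 0 : 'cV_n)) 0 0 = A i j.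
Proof.
have -> : adj n 1 (delta_mx i 0) = delta_mx 0 i :> 'rV[C]_n.
  by apply/matrixP => a b; rewrite !mxE conjC_nat andbC.
by rewrite -rowE -colE !mxE.
Qed.

Lemma psd_diag n (A : 'M[C]_n) i : psd n A -> 0 <= A i i.
Proof. by move=> /(_ (delta_mx i 0)); rewrite adj_delta_form. Qed.

Lemma psd_congr m n (A : 'M[C]_n) (B : 'M_(n, m)) :
  psd n A -> psd m (adj n m B *m A *m B).
Proof. by move=> A0 v; have := A0 (B *m v); rewrite adjM !mulmxA. Qed.

Lemma psd_diag_mx n (d : 'rV[C]_n) : (forall i, 0 <= d 0 i) -> psd n (diag_mx d).
Proof.
move=> d0 v; rewrite mul_mx_diag !mxE; apply: sumr_ge0 => i _; rewrite !mxE.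
by rewrite mulrAC mulr_ge0 // mulrC -normCK exprn_ge0.
Qed.

Lemma psd_hermitian n (A : 'M[C]_n) : psd n A -> adj n n A = A.
Proof. exact: form_ge0_hermitian. Qed.

Lemma complex_ge0 (z : C) : 0 <= z -> 0 <= complex.Re z /\ (complex.Re z)%:C = z.
Proof. by move=> z0; rewrite -lecR RRe_real ?ger0_real. Qed.

(** A positive semidefinite matrix is Hermitian, hence normal, hence unitarily diagonalisable. Each
    eigenvalue is a diagonal entry of a congruent positive semidefinite matrix, so it is a
    nonnegative real. *)
Lemma eigenvalue_psd_spectral D (Om : 'M[C]_D) : psd D Om ->
  exists (U : 'M[C]_D) (l : 'I_D -> R),
    [/\ U *m adj D D U = 1%:M, Om = adj D D U *m diag_mx (\row_i (l i)%:C) *m U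
      & forall i, 0 <= l i].
Proof.
move=> Om0; have /orthomx_spectralP E : Om \is normalmx.
  by apply/normalmxP; rewrite -[(_ ^t _)%sesqui]/(adj D D Om) psd_hermitian.
have Uu := spectral_unitarymx Om; have UU := unitarymxP Uu.
move: E; rewrite invmx_unitary //.
move: UU; rewrite -[(_ ^t _)%sesqui]/(adj D D (spectralmx Om)).
move: (spectralmx _) (spectral_diag _) => U sp UU E.
exists U, (fun i => complex.Re (sp 0 i)).
have dE : diag_mx sp = adj D D (adj D D U) *m Om *m adj D D U.
  by rewrite adjK E !mulmxA UU mul1mx -mulmxA UU mulmx1.
have sp0 i : 0 <= sp 0 i.
  have -> : sp 0 i = (diag_mx sp) i i by rewrite !mxE eqxx.
  by rewrite dE; apply/psd_diag/psd_congr.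
split; [exact: UU| |by move=> i; have [] := complex_ge0 _ (sp0 i)].
rewrite {1}E; congr (_ *m diag_mx _ *m _); apply/rowP => i.
by rewrite mxE; have [_ ->] := complex_ge0 _ (sp0 i).
Qed.

Lemma eigenvalue_unitary_diag D (U : 'M[C]_D) (l : 'rV_D) a :
  U *m adj D D U = 1%:M ->
  eigenvalue (adj D D U *m diag_mx l *m U) a -> exists i, l 0 i = a.
Proof.
move=> UU /eigenvalueP[v ve v0]; have w0 : v *m adj D D U != 0.
  apply: contra_neq v0 => /(congr1 (mulmx^~ U)).
  by rewrite -mulmxA (mulmx1C UU) mulmx1 mul0mx.
have /rV0Pn[i wi] := w0; exists i; apply: (mulfI wi).
move/(congr1 (mulmx^~ (adj D D U))): ve.
rewrite !mulmxA -[_ *m U *m _]mulmxA UU mulmx1 mul_mx_diag -scalemxAl.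
by move=> /rowP /(_ i); rewrite mxE [RHS]mxE => ->; rewrite mulrC.
Qed.

Lemma row_eigenspace D (U : 'M[C]_D) (l : 'rV_D) i :
  U *m adj D D U = 1%:M ->
  (row i U <= eigenspace (adj D D U *m diag_mx l *m U) (l 0 i))%MS.
Proof.
move=> UU; apply/eigenspaceP; rewrite -row_mul !mulmxA UU mul1mx.
by apply/rowP => j; rewrite mul_diag_mx !mxE.
Qed.

Lemma unitary_row_neq0 D (U : 'M[C]_D) i : U *m adj D D U = 1%:M -> row i U != 0.
Proof.
move=> UU; apply/eqP => ui0; have := row_mul_adj _ _ _ U U i i.
by rewrite UU ui0 mul0mx !mxE eqxx => /eqP; rewrite eq_sym oner_eq0.
Qed.

(** The coordinates of [Psi] vanish wherever the eigenvalue is not 1, and nondegeneracy leaves a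
    single index [o]. The remaining coordinate is only a phase, which cancels in the projector;
    hence the statement about [Psi *m adj D 1 Psi]. *)
Lemma verif_op_diag D (Om : 'M[C]_D) (Psi : 'cV[C]_D) (beta : R) :
  verif_op D Om Psi -> second_eig D Om beta ->
  exists (U : 'M[C]_D) (l : 'I_D -> R) (o : 'I_D),
    [/\ U *m adj D D U = 1%:M,
        Om = adj D D U *m diag_mx (\row_i (l i)%:C) *m U,
        Psi *m adj D 1 Psi = adj D D U *m diag_mx (\row_i (i == o)%:R) *m U,
        l o = 1 &
        [/\ forall i, i != o -> 0 <= l i <= beta,
            exists2 i, i != o & l i = beta &
            eigenvalue Om 0 -> exists2 i, i != o & l i = 0]].
Proof.
move=> [Psi1 Om0 _ OmPsi rk1] [eb b1 maxb].
have [U [l [UU OmE l0]]] := eigenvalue_psd_spectral _ _ Om0.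
have eig i : (row i U <= eigenspace Om (l i)%:C)%MS.
  by have := row_eigenspace _ _ (\row_i (l i)%:C) i UU; rewrite -OmE mxE.
have eigl i : eigenvalue Om (l i)%:C.
  apply/eigenvalueP; exists (row i U); last exact: unitary_row_neq0.
  exact/eigenspaceP.
have UU' := mulmx1C UU.
have dotU i j : (row i U *m adj 1 D (row j U)) 0 0 = (i == j)%:R.
  by rewrite row_mul_adj UU mxE.
pose w := U *m Psi; have PsiE : Psi = adj D D U *m w by rewrite mulmxA UU' mul1mx.
have w1 : (adj D 1 w *m w) 0 0 = 1 by rewrite adjM mulmxA -(mulmxA _ _ U) UU' mulmx1.
have wl i : (l i)%:C * w i 0 = w i 0.
  have : diag_mx (\row_i (l i)%:C) *m w = w.
    by rewrite {2}/w -OmPsi OmE !mulmxA UU mul1mx.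
  by move=> /colP /(_ i); rewrite mul_diag_mx !mxE.
clearbody w.
have [o wo] : exists o, w o 0 != 0.
  by apply/cV0Pn; apply/eqP => w0; move/eqP: w1; rewrite w0 mulmx0 mxE eq_sym oner_eq0.
have lo : l o = 1.
  by apply: complexI; apply: (mulIf wo); rewrite wl mul1r.
(* A second index with eigenvalue 1 would put [row i U] on the line spanned by [row o U], against
   orthonormality of the rows. *)
have uniq i : i != o -> l i != 1.
  move=> io; apply/eqP => li.
  have sub : (row i U <= row o U)%MS.
    have rko : \rank (row o U) = 1%N by rewrite rank_rV unitary_row_neq0.
    apply: submx_trans (eig i) _; rewrite li -lo.
    have := mxrank_leqif_sup (eig o); rewrite lo.
    by move=> [_ <-]; rewrite rk1 rko.
  have [a ia] := sub_rVP sub.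
  have := dotU i i; rewrite {1}ia -scalemxAl mxE dotU eq_sym (negPf io) mulr0 eqxx.
  by move/eqP; rewrite eq_sym oner_eq0.
have wi i : i != o -> w i 0 = 0.
  move=> /uniq li; apply: contra_neq_eq li => w0.
  by apply: complexI; apply: (mulIf w0); rewrite wl mul1r.
have wwE : w *m adj D 1 w = diag_mx (\row_i (i == o)%:R).
  have woo : w o 0 * (w o 0)^*%R = 1.
    rewrite -w1 mxE (bigD1 o) //= big1 ?addr0; first by rewrite !mxE mulrC.
    by move=> i /wi wi0; rewrite wi0 mulr0.
  apply/matrixP => i j; rewrite mxE big_ord1 !mxE.
  have [->|io] := eqVneq i o; last by rewrite wi // mul0r mul0rn.
  have [->|jo] := eqVneq j o; first by rewrite woo ?eqxx.
  by rewrite (wi j jo) conjC0 mulr0 mulr0n.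
exists U, l, o; split; [exact: UU|exact: OmE| |exact: lo|].
  by rewrite {1}PsiE PsiE adjM adjK mulmxA -[_ *m w *m _]mulmxA wwE.
have other a : eigenvalue Om a%:C -> a != 1 -> exists2 i, i != o & l i = a.
  rewrite {1}OmE => ea a1; have [j] := eigenvalue_unitary_diag _ _ _ _ UU ea.
  rewrite mxE => /complexI li.
  by exists j => //; apply: contra_neq a1 => jo; rewrite -li jo lo.
split=> [i /uniq li||e0].
- have li1 : (l i)%:C != 1 by apply: contra_neq li => /complexI.
  by have := maxb _ (eigl i) li1; rewrite lecR l0.
- by apply: other eb _; apply: contra_neq b1 => ->.
- by apply: other e0 _; rewrite eq_sym oner_neq0.
Qed.
End Spectral.

(** * Tensor powers, permutation operators and the product eigenbasis *)

Section Tensor.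
Variables (R : realType) (N D : nat).
Local Notation C := (R[i]).
Local Notation T := (tidx N D).
Implicit Types (A B : 'I_N.+1 -> 'M[C]_D) (E G : T -> T -> C).

Lemma sum_tdim (g : T -> C) : \sum_(i < tdim N D) g (enum_val i) = \sum_x g x.
Proof. by rewrite -big_enum_val. Qed.

Lemma eq_tmx E G : (forall x y, E x y = G x y) -> tmx N D E = tmx N D G.
Proof. by move=> e; apply/matrixP => i j; rewrite !mxE. Qed.

Lemma mul_tmx E G :
  tmx N D E *m tmx N D G = tmx N D (fun x z => \sum_y E x y * G y z).
Proof.
apply/matrixP => i j; rewrite !mxE -sum_tdim.
by apply: eq_bigr => k _; rewrite !mxE.
Qed.

Lemma adj_tmx E : adj _ _ (tmx N D E) = tmx N D (fun x y => (E y x)^*%R).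
Proof. by apply/matrixP => i j; rewrite !mxE. Qed.

Lemma tmx_mxE (M : 'M[C]_(tdim N D)) :
  M = tmx N D (fun x y => M (enum_rank x) (enum_rank y)).
Proof. by apply/matrixP => i j; rewrite mxE !enum_valK. Qed.

Lemma tmx_diag (q : T -> C) :
  tmx N D (fun x y => q x *+ (x == y)) = diag_mx (\row_i q (enum_val i)).
Proof. by apply/matrixP => i j; rewrite !mxE (inj_eq enum_val_inj). Qed.

Lemma mul_tens A B : tens N D A *m tens N D B = tens N D (fun k => A k *m B k).
Proof.
rewrite mul_tmx; apply: eq_tmx => x z; under [RHS]eq_bigr do rewrite mxE.
rewrite bigA_distr_bigA; apply: eq_bigr => y _; exact/esym/big_split.
Qed.

Lemma tens_diag (d : 'I_N.+1 -> 'I_D -> C) :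
  tens N D (fun k => diag_mx (\row_i d k i))
  = diag_mx (\row_i \prod_k d k ((enum_val i : T) k)).
Proof.
rewrite -(tmx_diag (fun x => \prod_k d k (x k))); apply: eq_tmx => x y.
have [<-|/eqP xy] := eqVneq x y.
  by apply: eq_bigr => k _; rewrite !mxE eqxx.
have [k xk] : exists k, x k != y k.
  by apply/existsP; rewrite -negb_forall; apply: contra_notN xy => /forallP e;
     apply/ffunP => k; apply/eqP.
by rewrite (bigD1 k) //= !mxE (negPf xk) mul0r.
Qed.

Lemma tens1 : tens N D (fun=> 1%:M) = 1%:M :> 'M[C]__.
Proof.
have e n : 1%:M = diag_mx (\row_i 1) :> 'M[C]_n by apply/matrixP => i j; rewrite !mxE.
rewrite !e (tens_diag (fun _ _ => 1)); congr diag_mx; apply/rowP => i.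
by rewrite !mxE big1.
Qed.

Lemma adj_tens A : adj _ _ (tens N D A) = tens N D (fun k => adj D D (A k)).
Proof.
rewrite adj_tmx; apply: eq_tmx => x y; rewrite rmorph_prod.
by apply: eq_bigr => k _; rewrite !mxE.
Qed.

(** The map of basis strings that [permop N D s] realises as a matrix. *)
Definition perm_idx (s : 'S_N.+1) (x : T) : T := [ffun k => x (s k)].

Lemma perm_idxK s : cancel (perm_idx s) (perm_idx s^-1).
Proof. by move=> x; apply/ffunP => k; rewrite !ffunE permKV. Qed.

Lemma perm_idxVK s : cancel (perm_idx s^-1) (perm_idx s).
Proof. by move=> x; apply/ffunP => k; rewrite !ffunE permK. Qed.

Lemma permop_conj s E :
  permop N D s *m tmx N D E *m adj _ _ (permop N D s)
  = tmx N D (fun x y => E (perm_idx s^-1 x) (perm_idx s^-1 y)).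
Proof.
rewrite adj_tmx !mul_tmx; apply: eq_tmx => x z.
have eqV u v : (u == perm_idx s v) = (v == perm_idx s^-1 u).
  by rewrite -[u in LHS](perm_idxVK s) (inj_eq (can_inj (perm_idxK s))) eq_sym.
rewrite (bigD1 (perm_idx s^-1 z)) //= [X in _ + X]big1 ?addr0 => [|y /negPf yz].
  rewrite -/(perm_idx s _) perm_idxVK eqxx conjC1 mulr1.
  rewrite (bigD1 (perm_idx s^-1 x)) //= big1 ?addr0 => [|y /negPf yx].
    by rewrite -/(perm_idx s _) perm_idxVK eqxx mul1r.
  by rewrite -/(perm_idx s y) eqV yx mul0r.
by rewrite -/(perm_idx s y) eqV yz conjC0 mulr0.
Qed.

(** All tensor factors are equal, so permuting them only reindexes the product. This lets the change
    of eigenbasis preserve permutation invariance. *)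
Lemma permop_tensC s (U : 'M[C]_D) :
  permop N D s *m tens N D (fun=> U) = tens N D (fun=> U) *m permop N D s.
Proof.
rewrite !mul_tmx; apply: eq_tmx => x z.
rewrite [RHS](bigD1 (perm_idx s z)) //= [X in _ + X]big1 ?addr0 => [|y /negPf yz].
  rewrite (bigD1 (perm_idx s^-1 x)) //= [X in _ + X]big1 ?addr0 => [|y yx].
    rewrite -!/(perm_idx s _) perm_idxVK !eqxx mul1r mulr1.
    rewrite (reindex_inj (@perm_inj _ s)) /=.
    by apply: eq_bigr => k _; rewrite !ffunE permK.
  rewrite -/(perm_idx s y); case: eqP => [xy|_]; last by rewrite mul0r.
  by rewrite xy perm_idxK eqxx in yx.
by rewrite -/(perm_idx s z) yz mulr0.
Qed.

Section Reduction.
Variables (U : 'M[C]_D).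
Hypothesis UU : U *m adj D D U = 1%:M.
Local Notation V := (tens N D (fun=> U)).

Lemma tens_unitary : V *m adj _ _ V = 1%:M.
Proof. by rewrite adj_tens mul_tens -tens1; congr tens; rewrite UU. Qed.

Definition product_weights (rho : 'M[C]_(tdim N D)) (x : T) : C :=
  (V *m rho *m adj _ _ V) (enum_rank x) (enum_rank x).

(** Cyclicity of the trace moves the unitaries onto [rho], and a trace against a diagonal matrix
    reads only diagonal entries. *)
Lemma mxtrace_tens_diag (d : 'I_N.+1 -> 'I_D -> C) rho :
  \tr (tens N D (fun k => adj D D U *m diag_mx (\row_i d k i) *m U) *m rho)
  = \sum_x product_weights rho x * \prod_k d k (x k).
Proof.
rewrite -2!mul_tens tens_diag -adj_tens -!mulmxA mxtrace_mulC -!mulmxA [V *m _]mulmxA.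
rewrite -(sum_tdim (fun x => product_weights rho x * \prod_k d k (x k))).
by apply: eq_bigr => i _; rewrite mul_diag_mx mxE [X in X * _]mxE mulrC /product_weights enum_valK.
Qed.

Lemma sum_product_weights rho : \sum_x product_weights rho x = \tr rho.
Proof.
rewrite -sum_tdim -[rho in RHS]mul1mx -(mulmx1C tens_unitary) -mulmxA mxtrace_mulC.
by apply: eq_bigr => i _; rewrite /product_weights enum_valK.
Qed.

(* Unqualified, [perm_inv] is MathComp's inverse of a permutation. *)
Lemma product_weights_perm rho s x :
  Defs.perm_inv N D rho -> product_weights rho (perm_idx s x) = product_weights rho x.
Proof.
move=> rhoS; set M := V *m rho *m adj _ _ V.
have MS : permop N D s *m M *m adj _ _ (permop N D s) = M.
  rewrite /M -{2}(rhoS s) -!mulmxA -adjM permop_tensC adjM !mulmxA.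
  by rewrite permop_tensC.
rewrite /product_weights -/M -[in LHS]MS [M in X in X *m _]tmx_mxE permop_conj.
by rewrite mxE !enum_rankK perm_idxK.
Qed.

(** Symmetric weights make the diagonal matrix invariant under [permop], and the unitary change of
    basis commutes with [permop]. *)
Lemma perm_inv_of_weights (q : T -> C) :
  (forall s x, q (perm_idx s x) = q x) ->
  Defs.perm_inv N D (adj _ _ V *m diag_mx (\row_i q (enum_val i)) *m V).
Proof.
move=> qS s; rewrite -[in RHS]tmx_diag.
have -> : tmx N D (fun x y => q x *+ (x == y))
   = permop N D s *m diag_mx (\row_i q (enum_val i)) *m adj _ _ (permop N D s).
  rewrite -tmx_diag permop_conj; apply: eq_tmx => x y.
  by rewrite qS (inj_eq (can_inj (perm_idxVK s))).
have PV : permop N D s *m adj _ _ V = adj _ _ V *m permop N D s.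
  by rewrite adj_tens permop_tensC.
have VP : V *m adj _ _ (permop N D s) = adj _ _ (permop N D s) *m V.
  by have := congr1 (adj _ _) PV; rewrite !adjM adjK.
by rewrite !mulmxA PV -!mulmxA VP.
Qed.

End Reduction.
End Tensor.

(** * Passage between invariant states and symmetric distributions *)

Section Weights.
Variables (R : realType) (N D : nat) (U Om : 'M[R[i]]_D) (l : 'I_D -> R).
Hypothesis UU : U *m adj D D U = 1%:M.
Hypothesis OmE : Om = adj D D U *m diag_mx (\row_i (l i)%:C) *m U.

(** Classical counterpart of [test_value]: the constant [h = 1] yields [p], the indicator of [o]
    yields [f], and that of its complement yields [g = p - f]. *)
Definition test_mean (q : tidx N D -> R) (h : 'I_D -> R) : R :=
  \sum_x q x * (h (x ord_max) * \prod_(k | k != ord_max) l (x k)).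

Definition test_value (A : 'M[R[i]]_D) (rho : 'M[R[i]]_(tdim N D)) : R[i] :=
  \tr (tens N D (fun k => if k == ord_max then A else Om) *m rho).

Lemma test_valueE A h rho q :
  A = adj D D U *m diag_mx (\row_i (h i)%:C) *m U ->
  (forall x, product_weights _ _ _ U rho x = (q x)%:C) ->
  test_value A rho = (test_mean q h)%:C.
Proof.
move=> AE rhoq; pose d (k : 'I_N.+1) i := (if k == ord_max then h i else l i)%:C.
have -> : test_value A rho =
    \tr (tens N D (fun k => adj D D U *m diag_mx (\row_i d k i) *m U) *m rho).
  congr (\tr (_ *m _)); apply: eq_tmx => x y; apply: eq_bigr => k _.
  by rewrite /d; case: eqP => _; rewrite ?AE ?OmE.
rewrite (mxtrace_tens_diag _ _ _ _ d) rmorph_sum; apply: eq_bigr => x _ /=.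
rewrite rhoq rmorphM rmorphM rmorph_prod (bigD1 ord_max) //= /d eqxx.
by congr (_ * (_ * _)); apply: eq_bigr => k /negPf ->.
Qed.

(** Serves the lower bounds: the diagonal of the state in the product eigenbasis is nonnegative,
    sums to the trace and inherits the symmetry. *)
Lemma weights_of_state rho : density _ rho -> Defs.perm_inv N D rho ->
  exists q : tidx N D -> R,
    [/\ forall x, 0 <= q x, \sum_x q x = 1, perm_symmetric N 'I_D q &
        forall A h, A = adj D D U *m diag_mx (\row_i (h i)%:C) *m U ->
          test_value A rho = (test_mean q h)%:C].
Proof.
move=> [rho0 rho1] rhoS.
have w0 x : 0 <= product_weights _ _ _ U rho x.
  apply: psd_diag; have := psd_congr _ _ _ _ (adj _ _ (tens N D (fun=> U))) rho0.
  by rewrite adjK.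
exists (fun x => complex.Re (product_weights _ _ _ U rho x)); split.
- by move=> x; have [] := complex_ge0 _ _ (w0 x).
- apply: complexI; rewrite rmorph_sum -[RHS]rho1 -(sum_product_weights _ _ _ _ UU) /=.
  by apply: eq_bigr => x _; have [_ ->] := complex_ge0 _ _ (w0 x).
- by move=> s x; rewrite -[in RHS](product_weights_perm _ _ _ _ rho s x rhoS).
move=> A h AE; apply: test_valueE AE _ => x.
by have [_ ->] := complex_ge0 _ _ (w0 x).
Qed.

(** Serves saturation: the state is taken diagonal in the product eigenbasis with entries [q]. *)
Lemma state_of_weights (q : tidx N D -> R) :
  (forall x, 0 <= q x) -> \sum_x q x = 1 -> perm_symmetric N 'I_D q ->
  exists rho : 'M[R[i]]_(tdim N D), [/\ density _ rho, Defs.perm_inv N D rho &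
    forall A h, A = adj D D U *m diag_mx (\row_i (h i)%:C) *m U ->
      test_value A rho = (test_mean q h)%:C].
Proof.
move=> q0 q1 qS; pose V := tens N D (fun=> U).
have VV : V *m adj _ _ V = 1%:M by apply: tens_unitary.
pose rho := adj _ _ V *m diag_mx (\row_i (q (enum_val i))%:C) *m V.
have rhoq x : product_weights _ _ _ U rho x = (q x)%:C.
  rewrite /product_weights /rho -/V !mulmxA VV mul1mx -mulmxA VV mulmx1.
  by rewrite mxE mxE eqxx enum_rankK.
exists rho; split.
- split.
    by apply: psd_congr; apply: psd_diag_mx => i; rewrite mxE lecR.
  rewrite -(sum_product_weights _ _ _ _ UU).
  by under eq_bigr do rewrite rhoq; rewrite -rmorph_sum q1.
- by apply: (perm_inv_of_weights _ _ _ _ (fun x => (q x)%:C)) => s x; rewrite qS.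
by move=> A h AE; apply: test_valueE AE rhoq.
Qed.
End Weights.

(** * Averaged inequalities for [p] and [g] *)

Section Bounds.
Variables (R : realType) (N D : nat) (l : 'I_D -> R) (o : 'I_D) (b : R).
Variable q : tidx N D -> R.
Hypotheses (b0 : 0 <= b) (lo : l o = 1).
Hypothesis lb : forall i, i != o -> 0 <= l i <= b.
Hypotheses (q0 : forall x, 0 <= q x) (q1 : \sum_x q x = 1).
Hypothesis qS : perm_symmetric N 'I_D q.
Local Notation mean := (test_mean R N D l q).
Local Notation infid := (fun i : 'I_D => (i != o)%:R : R).

Lemma test_mean_split : mean (fun=> 1) = mean (fun i => (i == o)%:R) + mean infid.
Proof.
rewrite -big_split; apply: eq_bigr => x _ /=; rewrite -mulrDr -mulrDl.
by case: eqP => _; rewrite ?addr0 ?add0r.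
Qed.

(** After multiplication by [N.+1], symmetry turns both means into sums over the untested position;
    the pointwise bound is then averaged against [q], of total mass 1. *)
Lemma test_mean_tradeoff : b <= 1 -> N%:R * (1 - b) * mean infid + mean (fun=> 1) <= 1.
Proof.
move=> b1; rewrite -(ler_pM2l (ltr0Sn R N)) mulr1 mulrDr [_ * (_ * mean _)]mulrCA.
rewrite !sum_perm_symmetric // mulr_sumr -big_split /=.
rewrite -[leRHS]mulr1 -[X in _ <= _ * X]q1 mulr_sumr; apply: ler_sum => x _.
rewrite mulrCA -mulrDr mulrC; apply: ler_wpM2r; first exact: q0.
apply: le_trans (sum_tradeoff_le _ _ _ o l b b0 lo lb x b1); rewrite lerD2l.
by under eq_bigr do rewrite mul1r.
Qed.

Lemma test_mean_infidelity : b <= 1 / 2 -> N.+1%:R * mean infid <= 1.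
Proof.
move=> b12; rewrite sum_perm_symmetric // -[leRHS]q1; apply: ler_sum => x _.
rewrite -[leRHS]mulr1; apply: ler_wpM2l; first exact: q0.
exact: (sum_infidelity_le1 _ _ _ o l b b0 lo lb x b12).
Qed.
End Bounds.

(** * Assembly of the lower bounds and the saturating states *)

(** The tradeoff gives [g <= (1 - p) / (N * nu)], and [(1 - p) / p] decreases in [p], so its worst
    case is [p = delta]. *)
Lemma infidelity_ratio_le (R : realType) (N : nat) (nu delta p g : R) :
  (0 < N)%N -> 0 < nu -> 0 < delta -> delta <= p -> N%:R * nu * g + p <= 1 ->
  g / p <= (1 - delta) / (N%:R * nu * delta).
Proof.
move=> N0 nu0 d0 dp h; have p0 := lt_le_trans d0 dp.
have Nnu0 : 0 < N%:R * nu by rewrite mulr_gt0 ?ltr0n.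
rewrite ler_pdivrMr // mulrAC ler_pdivlMr; last exact: mulr_gt0.
apply: le_trans (_ : delta * (1 - p) <= _); last by nra.
by rewrite mulrA mulrC ler_pM2l // mulrC; lra.
Qed.

Theorem theorem5 (R : realType) (D N : nat) (Om : 'M[R[i]]_D) (Psi : 'cV[R[i]]_D)
    (beta delta : R) :
  (2 <= D)%N -> (1 <= N)%N ->
  verif_op D Om Psi -> second_eig D Om beta ->
  0 < delta <= 1 -> 0 < 1 - beta <= 1 ->
  let nu := 1 - beta in
  let deltas := (1 + N%:R * beta) / (N%:R + 1) in
  F_ge N D delta Om Psi (1 - (1 - delta) / (N%:R * nu * delta)) /\
  (deltas <= delta -> F_eq N D delta Om Psi (1 - (1 - delta) / (N%:R * nu * delta))) /\
  (1 / 2 <= nu ->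
     F_ge N D delta Om Psi (1 - 1 / ((N%:R + 1) * delta)) /\
     (eigenvalue Om 0 -> 1 / (N%:R + 1) <= delta <= deltas ->
        F_eq N D delta Om Psi (1 - 1 / ((N%:R + 1) * delta)))).
Proof.
move=> _ N0 Omv Omb /andP[d0 d1] /andP[nu0 nu1] nu deltas.
have b0 : 0 <= beta by move: nu1; lra.
have b1 : beta <= 1 by move: nu0; lra.
have [U [l [o [UU OmE PsiE lo [lb [i1 i1o li1] ev0]]]]] := verif_op_diag _ _ _ _ _ Omv Omb.
have oneE : 1%:M = adj D D U *m diag_mx (\row_i (1 : R)%:C) *m U.
  have -> : diag_mx (\row_i (1 : R)%:C) = 1%:M :> 'M_D.
    by apply/matrixP => i j; rewrite !mxE.
  by rewrite mulmx1 (mulmx1C UU).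
have {}PsiE : Psi *m adj D 1 Psi
    = adj D D U *m diag_mx (\row_i ((i == o)%:R : R)%:C) *m U.
  rewrite PsiE; congr (_ *m diag_mx _ *m _); apply/rowP => i.
  by rewrite !mxE rmorph_nat.
have pfE (p f : R) : f%:C / p%:C = (f / p)%:C by rewrite rmorphM fmorphV.
pose mean (q : tidx N D -> R) := test_mean R N D l q.
(* Since [f / p = 1 - g / p], each lower bound on [F] reduces to real arithmetic on [p] and [g]. *)
have geF bd : (forall p g : R, delta <= p -> N%:R * nu * g + p <= 1 ->
     (beta <= 1 / 2 -> N.+1%:R * g <= 1) -> g / p <= 1 - bd) -> F_ge N D delta Om Psi bd.
  move=> hbd rho [rhod rhoS dp].
  have [q [q0 q1 qS qE]] := weights_of_state _ _ _ _ _ _ UU OmE _ rhod rhoS.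
  have pE : p_rho N D Om rho = (mean q (fun=> 1))%:C := qE _ _ oneE.
  have fE : f_rho N D Om Psi rho = (mean q (fun i => (i == o)%:R))%:C := qE _ _ PsiE.
  move: dp; rewrite pE fE pfE !lecR => dp.
  have split1 := test_mean_split R N D l o q.
  have tr := test_mean_tradeoff _ _ _ _ _ _ _ b0 lo lb q0 q1 qS b1.
  have inf := test_mean_infidelity _ _ _ _ _ _ _ b0 lo lb q0 q1 qS.
  have := hbd _ _ dp tr inf; rewrite -/(mean q) in split1 *.
  have p0 : mean q (fun=> 1) != 0 by rewrite gt_eqF // (lt_le_trans d0).
  by rewrite -(addrK (mean q (fun i => (i != o)%:R)) (mean q (fun i => (i == o)%:R)))
             -split1 mulrBl divff //; lra.
(* Saturating family: the single flipped letter is [a] with probability [1 - t] and [c] with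
   probability [t]. Its mean eigenvalue [s] is tuned so that [p] equals [delta] exactly. *)
have eqF bd t a c : 0 <= t <= 1 ->
    let s := (1 - t) * l a + t * l c in
    (1 + N%:R * s) / (N%:R + 1) = delta ->
    ((1 - t) * (a == o)%:R + t * (c == o)%:R + N%:R * s) / (N%:R + 1) / delta = bd ->
    F_ge N D delta Om Psi bd -> F_eq N D delta Om Psi bd.
  move=> /andP[t0 t1] s pd fd ge; split=> //.
  pose w i : R := (1 - t) * (i == a)%:R + t * (i == c)%:R.
  have w0 i : 0 <= w i by rewrite addr_ge0 // mulr_ge0 ?ler0n ?subr_ge0.
  have sumw (phi : 'I_D -> R) : \sum_i w i * phi i = (1 - t) * phi a + t * phi c.
    have pick a' : \sum_i (i == a')%:R * phi i = phi a'.
      rewrite (bigD1 a') //= eqxx mul1r big1 ?addr0 // => i /negPf ->.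
      by rewrite mul0r.
    under eq_bigr do rewrite mulrDl -!mulrA.
    by rewrite big_split /= -!mulr_sumr !pick.
  have w1 : \sum_i w i = 1.
    by under eq_bigr do rewrite -[w _]mulr1; rewrite (sumw (fun=> 1)); ring.
  pose q := one_flip_distr R N 'I_D o w.
  have meanE h : mean q h = ((1 - t) * h a + t * h c + N%:R * h o * s) / (N%:R + 1).
    by rewrite /mean /test_mean sum_one_flip_test // !sumw natr1.
  have [rho [rhod rhoS rhoE]] := state_of_weights _ _ _ _ _ _ UU OmE q
    (fun x => one_flip_ge0 _ _ _ _ _ x w0) (sum_one_flip1 _ _ _ _ _ w1)
    (one_flip_perm_symmetric _ _ _ _ _).
  have pE : p_rho N D Om rho = delta%:C.
    rewrite (_ : p_rho N D Om rho = (mean q (fun=> 1))%:C); last exact: rhoE oneE.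
    by rewrite meanE -pd; congr ((_ / _)%:C); ring.
  have fE : f_rho N D Om Psi rho / p_rho N D Om rho = bd%:C.
    rewrite pE (_ : f_rho N D Om Psi rho = (mean q (fun i => (i == o)%:R))%:C).
      by rewrite pfE meanE -fd eqxx mulr1.
    exact: rhoE PsiE.
  by exists rho; split=> //; split=> //; rewrite pE.
have N0R : 0 < N%:R :> R by rewrite ltr0n.
have ge1 : F_ge N D delta Om Psi (1 - (1 - delta) / (N%:R * nu * delta)).
  by apply: geF => p g dp tr _; rewrite subKr; apply: infidelity_ratio_le.
split; [exact: ge1 | split=> [dsd|nu12]].
  (* Solves [p = delta] for letters [o] and [i1], where [s = 1 - t * nu]; the condition [t <= 1] is
     precisely [deltas <= delta]. *)
  pose t := (1 - delta) * (N%:R + 1) / (N%:R * nu).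
  have Nnu : 0 < N%:R * nu by apply: mulr_gt0.
  have N1 : 0 < N%:R + 1 :> R by rewrite addr_gt0.
  apply: (eqF _ t o i1) => //.
  - rewrite divr_ge0 ?(ltW Nnu) //=; last by rewrite mulr_ge0 ?subr_ge0 // ltW.
    rewrite ler_pdivrMr // mul1r.
    by move: dsd; rewrite /deltas ler_pdivrMr // /nu; lra.
  - by rewrite lo li1 /t /nu; field; rewrite !gt_eqF.
  rewrite lo li1 eqxx (negPf i1o) mulr0 addr0 !mulr1 /t /nu; field; by rewrite !gt_eqF.
have b12 : beta <= 1 / 2 by move: nu12; rewrite /nu; lra.
have N1 : 0 < N%:R + 1 :> R by rewrite addr_gt0.
have ge2 : F_ge N D delta Om Psi (1 - 1 / ((N%:R + 1) * delta)).
  (* Here [g <= 1 / (N + 1)] and [p >= delta] are combined directly. *)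
  apply: geF => p g dp _ /(_ b12); rewrite subKr -natr1 => inf.
  have p0 := lt_le_trans d0 dp.
  rewrite ler_pdivrMr // mulrAC ler_pdivlMr ?mulr_gt0 // mul1r mulrA.
  apply: le_trans dp; rewrite -[leRHS]mul1r; apply: ler_wpM2r; first exact: ltW.
  by rewrite mulrC.
split=> [|/ev0[i0 i0o li0] /andP[dlo dhi]]; first exact: ge2.
(* For [beta = 0] this is [0], and [delta] is forced to be [1 / (N + 1)]. *)
pose t := (delta * (N%:R + 1) - 1) / (N%:R * beta).
have num0 : 0 <= delta * (N%:R + 1) - 1 by move: dlo; rewrite ler_pdivrMr // subr_ge0.
have numb : delta * (N%:R + 1) - 1 <= N%:R * beta.
  by move: dhi; rewrite /deltas ler_pdivlMr //; lra.
have Nb0 : 0 <= N%:R * beta by rewrite mulr_ge0 // ltW.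
have tE : N%:R * ((1 - t) * l i0 + t * l i1) = delta * (N%:R + 1) - 1.
  rewrite li0 li1 mulr0 add0r mulrCA /t; case: (eqVneq (N%:R * beta) 0) => [e|ne].
    by rewrite e mulr0; apply/eqP; rewrite eq_le num0 -e numb.
  by rewrite divfK.
(* Both letters differ from [o], so [g] is exactly [1 / (N + 1)], while [s = t * beta] sweeps
   [[0, beta]] and [p] the range from [1 / (N + 1)] to [deltas]. *)
apply: (eqF _ t i0 i1) ge2.
- rewrite divr_ge0 //=; case: (eqVneq (N%:R * beta) 0) => [e|ne].
    by rewrite /t e invr0 mulr0.
  by rewrite ler_pdivrMr ?mul1r // lt_def ne.
- by rewrite tE; field; rewrite gt_eqF.
by rewrite (negPf i0o) (negPf i1o) !mulr0 !add0r tE; field; rewrite !gt_eqF.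
Qed.
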